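(* Let $a_0,a_1,a_2,b_0,b_1$ be arbitrary complex parameters, and suppose that the $6$ coefficients $c_0,\dots,c_5$ of the monic sextic polynomial $P_6(x)=x^6+\sum_{n=0}^{5}c_nx^n$ are given by $$c_5=3b_1,\qquad c_4=a_2+3\left(b_0+b_1^2\right),\qquad c_3=\left(2a_2+6b_0+b_1^2\right)b_1,$$ $$c_2=a_1+a_2\left(2b_0+b_1^2\right)+3b_0\left(b_0+b_1^2\right),\qquad c_1=a_1b_1+2a_2b_0b_1+3b_0^2b_1,$$ $$c_0=a_0+a_1b_0+a_2b_0^2+b_0^3 .$$ Then the $6$ roots $z_{\lambda\mu}$ ($\lambda=1,2$; $\mu=1,2,3$) of $P_6$ are given as follows: let $y_1,y_2,y_3$ be the $3$ roots of the cubic equation $$y^3+a_2y^2+a_1y+a_0=0,$$ and, for each $\mu=1,2,3$, let $z_{1\mu},z_{2\mu}$ be the $2$ roots of the quadratic equation in $z$ $$z^2+b_1z+b_0=y_\mu .$$ Then $z_{\lambda\mu}$, $\lambda=1,2$, $\mu=1,2,3$, are the $6$ roots of $P_6$.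
   Context: All coefficients, parameters and roots are complex numbers, and roots of polynomials are listed with multiplicity; thus the assertion that the numbers $z_{\lambda\mu}$ are the $6$ roots of $P_6$ means $P_6(x)=\prod_{\lambda=1}^{2}\prod_{\mu=1}^{3}(x-z_{\lambda\mu})$. *)

(* Defs.v *)
From mathcomp Require Import all_boot all_order all_algebra.
From mathcomp Require Import complex reals.

(* Main.v *)
Require Import Defs.
From mathcomp Require Import all_boot all_order all_algebra.
From mathcomp Require Import complex reals ring.
Import GRing.Theory.
Local Open Scope ring_scope.
Local Open Scope complex_scope.

(** The sextic is a composition: with [q] the quadratic X^2 + b1 X + b0, the prescribed [c] are the
    coefficients of the cubic evaluated at [q]. Substituting [q] into the factored cubic gives the
    product of the q - y_mu, and each of these factors splits by [hz]. *)

Theorem mainTheorem3 (R : realType) (a0 a1 a2 b0 b1 : R[i])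
    (c : 6.-tuple R[i])
    (hc5 : c`_5 = 3 * b1)
    (hc4 : c`_4 = a2 + 3 * (b0 + b1 ^+ 2))
    (hc3 : c`_3 = (2 * a2 + 6 * b0 + b1 ^+ 2) * b1)
    (hc2 : c`_2 = a1 + a2 * (2 * b0 + b1 ^+ 2) + 3 * b0 * (b0 + b1 ^+ 2))
    (hc1 : c`_1 = a1 * b1 + 2 * a2 * b0 * b1 + 3 * b0 ^+ 2 * b1)
    (hc0 : c`_0 = a0 + a1 * b0 + a2 * b0 ^+ 2 + b0 ^+ 3)
    (y : 'I_3 -> R[i]) (z : 'I_2 -> 'I_3 -> R[i])
    (hy : 'X^3 + a2 *: 'X^2 + a1 *: 'X + a0%:P
          = \prod_(mu < 3) ('X - (y mu)%:P))
    (hz : forall mu : 'I_3,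
          'X^2 + b1 *: 'X + b0%:P - (y mu)%:P
          = \prod_(lambda < 2) ('X - (z lambda mu)%:P)) :
  'X^6 + \sum_(n < 6) c`_n *: 'X^n
  = \prod_(lambda < 2) \prod_(mu < 3) ('X - (z lambda mu)%:P).
Proof.
rewrite exchange_big /= (eq_bigr _ (fun mu _ => esym (hz mu))) /=.
set q := 'X^2 + b1 *: 'X + b0%:P.
(* Composition with [q] is a ring morphism, so it carries the factorization [hy] over factor by
   factor. *)
have -> : \prod_(mu < 3) (q - (y mu)%:P)
    = ('X^3 + a2 *: 'X^2 + a1 *: 'X + a0%:P) \Po q.
  rewrite hy rmorph_prod /=; apply: eq_bigr => mu _.
  by rewrite comp_polyB comp_polyX comp_polyC.
rewrite !comp_polyD !comp_polyZ !comp_Xn_poly comp_polyX comp_polyC /q.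
rewrite !big_ord_recl big_ord0 /= hc0 hc1 hc2 hc3 hc4 hc5 -!mul_polyC.
(* Pushing [%:P] down to the parameters leaves a commutative-ring identity in ['X] and the constants
   [a0%:P], ..., [b1%:P]. *)
rewrite !(polyCD, polyCM, polyC_exp, polyC_natr).
ring.
Qed.
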